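(* Let $(A,\Omega)$ be a regular uniform algebra and $S\subseteq G(A)$. Then (i) the logarithmic extension $A^{\log S}$ is regular, and (ii) if $G(A)$ is dense in $A$ then $G(A^{\log S})$ is dense in $A^{\log S}$.
   Context: $G(B)$ is the group of invertible elements of $B$. A uniform algebra $(A,X)$ is a supremum-norm-closed subalgebra of $C(X)$ ($X$ compact Hausdorff) separating points and containing the constants. It is regular if for each closed subset $E$ of its character space (weak-* topology) and each character $\omega\notin E$ there is $a\in A$ with $\hat a(E)\subseteq\{0\}$, $\hat a(\omega)=1$, where $\hat a(\omega)=\omega(a)$. Regular uniform algebras are natural (every character is evaluation at a point of the underlying space), so $\Omega$ is identified with the character space of $A$. For each $a\in G(A)$ a norm parameter $t_a>0$ is fixed, i.e. a number for which there exist $b_1,\dots,b_m\in A$ and open sets $V_1,\dots,V_m$ covering $\Omega$ such that $e^{b_k(\omega)}=a(\omega)$ for $\omega\in V_k$ and $\|b_k\|\le t_a$ ($k=1,\dots,m$); such $b_k,V_k$ exist because $A$ is regular. For $S\subseteq G(A)$ let $$\Omega_{\log S}=\{(\omega,\lambda)\in\Omega\times\mathbb{C}^{S}:\ |\lambda_a|\le t_a\text{ and }e^{\lambda_a}=a(\omega)\text{ for all }a\in S\}$$ with the relative product topology (a compact Hausdorff space), $\pi:\Omega_{\log S}\to\Omega$, $(\omega,\lambda)\mapsto\omega$, and $p_a:\Omega_{\log S}\to\mathbb{C}$, $(\omega,\lambda)\mapsto\lambda_a$. The uniform algebra $A^{\log S}$ on $\Omega_{\log S}$ is the closed subalgebra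 of $C(\Omega_{\log S})$ generated by $\{f\circ\pi:f\in A\}\cup\{p_a:a\in S\}$. *)

(* Defs.v *)
From HB Require Import structures.
From mathcomp Require Import all_boot all_order all_algebra.
From mathcomp Require Import all_classical all_reals all_analysis.
From mathcomp Require Import complex.

Set Implicit Arguments.
Unset Strict Implicit.
Unset Printing Implicit Defensive.

Import Order.TTheory GRing.Theory Num.Theory.
Import numFieldNormedType.Exports.

Local Open Scope classical_set_scope.
Local Open Scope ring_scope.
Local Open Scope complex_scope.

(* R[i] carries the topology and uniformity of its modulus. *)
HB.instance Definition _ (R : realType) := NormedModule.copy R[i] R[i]^o.

Definition cexp (R : realType) (z : R[i]) : R[i] :=
  (expR (complex.Re z) * cos (complex.Im z))
    +i* (expR (complex.Re z) * sin (complex.Im z)).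

Section UniformAlgebras.
Context {R : realType} {X : topologicalType}.
Implicit Types (A B F : set (X -> R[i])) (f g : X -> R[i]).

Definition subalgebra A : Prop :=
  [/\ A 0,
      forall f g, A f -> A g -> A (f + g),
      forall (c : R[i]) f, A f -> A (c *: f)
    & forall f g, A f -> A g -> A (f * g)].

(* When X is compact, the topology that {uniform X -> R[i]} induces on C(X)
   is that of the supremum norm. *)
Definition closed_subalgebra A : Prop :=
  [/\ subalgebra A,
      forall f, A f -> continuous f
    & closed (A : set {uniform X -> R[i]})].

Definition separates_points A : Prop :=
  forall x y : X, x <> y -> exists2 f, A f & f x <> f y.

Record uniform_algebra A : Prop := UniformAlgebra {
  ua_compact : compact [set: X];
  ua_hausdorff : hausdorff_space X;
  ua_closed_subalgebra : closed_subalgebra A;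
  ua_constants : forall c : R[i], A (cst c);
  ua_separates_points : separates_points A
}.

Definition generated_closed_subalgebra F : set (X -> R[i]) :=
  smallest closed_subalgebra F.

Definition invertibles A : set (X -> R[i]) :=
  [set f | A f /\ exists2 g, A g & f * g = 1].

Definition invertibles_dense A : Prop :=
  A `<=` closure (invertibles A : set {uniform X -> R[i]}).

(* A character is a nonzero algebra homomorphism A -> C.  The type [set_type A]
   has no algebra structure, so that the morphism laws relate an h in A to the
   f, g in A of which it is the sum, multiple or product in C(X). *)
Definition is_character A (phi : A -> R[i]) : Prop :=
  [/\ forall f g h : A,
        set_val h = set_val f + set_val g -> phi h = phi f + phi g,
      forall (c : R[i]) (f h : A), set_val h = c *: set_val f -> phi h = c * phi f,
      forall f g h : A,
        set_val h = set_val f * set_val g -> phi h = phi f * phi g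
    & exists f : A, phi f <> 0].

(* [prod_topology] is pointwise convergence on A, i.e. the weak-* topology. *)
Definition character_space A :=
  set_type [set phi : prod_topology (fun _ : A => R[i]) | is_character phi].

Definition gelfand A (a : A) (omega : character_space A) : R[i] :=
  set_val omega a.

Definition regular A : Prop :=
  forall (E : set (character_space A)) (omega : character_space A),
    closed E -> ~ E omega ->
    exists a : A, gelfand a @` E `<=` [set 0] /\ gelfand a omega = 1.

Definition norm_parameter A (a : X -> R[i]) (r : R) : Prop :=
  0 < r /\
  exists (m : nat) (b : 'I_m -> X -> R[i]) (V : 'I_m -> set X),
    [/\ forall k, A (b k),
        forall k, open (V k),
        \bigcup_k V k = [set: X],
        forall k x, V k x -> cexp (b k x) = a x
      & forall k x, `|b k x| <= r%:C].

End UniformAlgebras.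

Section LogExtension.
Context {R : realType} {Omega : topologicalType}.
Variables (A : set (Omega -> R[i])) (t : (Omega -> R[i]) -> R).
Variable S : set (Omega -> R[i]).

Definition log_set : set (Omega * prod_topology (fun _ : S => R[i])) :=
  [set x | forall a : S,
    `|x.2 a| <= (t (set_val a))%:C /\ cexp (x.2 a) = set_val a x.1].

Definition log_space := set_type log_set.

Definition log_proj (x : log_space) : Omega := (set_val x).1.

Definition log_coord (a : S) (x : log_space) : R[i] := (set_val x).2 a.

Definition log_extension : set (log_space -> R[i]) :=
  generated_closed_subalgebra
    ([set f \o log_proj | f in A] `|` range log_coord).

End LogExtension.

Arguments log_set {R Omega} t S.
Arguments log_space {R Omega} t S.
Arguments log_extension {R Omega} A t S.

(* Main.v *)
Require Import Defs.
From mathcomp Require Import all_boot all_order all_algebra.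
From mathcomp Require Import all_classical all_reals all_analysis.
From mathcomp Require Import complex.
From mathcomp Require Import ring lra.

Set Implicit Arguments.
Unset Strict Implicit.
Unset Printing Implicit Defensive.

Import Order.TTheory GRing.Theory Num.Theory.
Import numFieldNormedType.Exports.
Import ComplexField.Normc.

Local Open Scope classical_set_scope.
Local Open Scope ring_scope.
Local Open Scope complex_scope.

(** Write B for the logarithmic extension, and pull functions on Omega back
    along the projection of the extended space Y onto Omega.  The proof rests
    on one observation about the new generators.  If b is one of the local
    logarithms of a, then over the open set V where exp b = a every value of
    the coordinate p_a has the form b + 2 pi i n, and the bound t_a leaves only
    finitely many n.  Since finitely many sets V cover Omega, there is a single
    finite list L of elements of A such that at every point y of Y the value of
    p_a at y is the value of some F in L at the projection of y
    ([norm_parameter_branches], [log_coord_finitely_branched]).  Call such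
    functions finitely branched.  They form a subalgebra containing the
    generators, hence a dense subset of B, and each of them is a root of the
    monic polynomial P(z) = prod_(F in L) (z - F) with coefficients in A.

    Density of the invertible group.  Take g in B finitely branched with list
    L.  As the invertible elements of A form an open dense set, a finite
    intersection of translates of this set is dense, so a small h in A makes
    every F - h with F in L invertible ([shift_all_invertible]).  In B one has
    P(g) = 0, and P(g) - P(h) is divisible by g - h, so g - h divides the
    invertible element P(h) and is invertible ([shift_branched_invertible]).

    Regularity.  In a regular algebra all characters are evaluations, because
    an element that vanishes on all evaluations is zero
    ([regular_natural]).  So A has, for each closed set and each point off it,
    a function that is 0 on the set and 1 at the point.  A character phi of B
    restricts on A to evaluation at a point x.  Let V be one of the open sets
    above that contains x.  A bump at x supported in V, times the product of
    p_a - F over the branches F that belong to V, is zero, so phi(p_a) is the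
    value at x of such a branch, hence a logarithm of a(x).  Thus x and the
    numbers phi(p_a) define a point y of Y, and phi agrees with evaluation at y
    on generators, hence, being contractive, on B ([log_extension_natural]).
    It remains to find bumps in B.  The sets U outside of which some b in B
    with b(y) <> 0 vanishes form a filter.  This filter converges to y because
    the projection and all the p_a converge along it: a finitely branched g is
    within e of g(y) wherever neither a suitable bump at the projection of y
    nor the product of g - F over the branches F that miss g(y) vanishes
    ([zero_neighbourhoods_branched], [log_extension_bump]). *)

(** * Complex numbers and the exponential *)

Section Complex.
Context {R : realType}.
Implicit Types z w : R[i].

Lemma normcE z : `|z| = (normc z)%:C. Proof. by []. Qed.

Lemma normc_ge0 z : 0 <= normc z.
Proof. by case: z => a b; exact: sqrtr_ge0. Qed.

Lemma normc_sub z w : normc (z - w) = normc (w - z).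
Proof. by rewrite -normcN opprB. Qed.

Lemma normcX z n : normc (z ^+ n) = normc z ^+ n.
Proof. by elim: n => [|n IH]; rewrite ?expr0 ?normc1// !exprS normcM IH. Qed.

Lemma Re_le_normc z : `|complex.Re z| <= normc z.
Proof.
by case: z => a b /=; rewrite -sqrtr_sqr ler_sqrt ?lerDl ?addr_ge0 ?sqr_ge0.
Qed.

Lemma Im_le_normc z : `|complex.Im z| <= normc z.
Proof.
by case: z => a b /=; rewrite -sqrtr_sqr ler_sqrt ?lerDr ?addr_ge0 ?sqr_ge0.
Qed.

Lemma normc_le_ReIm z : normc z <= `|complex.Re z| + `|complex.Im z|.
Proof.
case: z => a b /=.
rewrite -[leRHS]ger0_norm ?addr_ge0// -[leRHS]sqrtr_sqr ler_sqrt ?sqr_ge0//.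
by rewrite sqrrD !real_normK ?num_real// lerD2r lerDl mulrn_wge0 // mulr_ge0.
Qed.

Lemma normc_small_eq z w :
  (forall e : R, 0 < e -> normc (z - w) <= e) -> z = w.
Proof.
move=> h; apply/eqP; rewrite -subr_eq0; apply/eqP/eq0_normc/eqP.
rewrite eq_le normc_ge0 andbT; apply/ler_addgt0Pr => e e0.
by rewrite add0r h.
Qed.

(** Neighbourhoods in [R[i]] are given by radii in [R[i]], whose order is
    partial; real radii make linear arithmetic available. *)
Lemma cvg_normcP {T : Type} {F : set_system T} {FF : Filter F} (f : T -> R[i])
    z :
  f @ F --> z <-> forall e : R, 0 < e -> \forall t \near F, normc (f t - z) < e.
Proof.
split=> [/cvgrPdist_lt h e e0|h].
  have := h e%:C; rewrite ltcR => /(_ e0); apply: filterS => t.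
  by rewrite normcE ltcR normc_sub.
apply/cvgrPdist_lt => -[e e'] /= ; rewrite ltcE /= => /andP[/eqP -> e0].
apply: filterS (h _ e0) => t.
by rewrite -/(e%:C) ltcR normc_sub.
Qed.

Lemma cvg_complexP {T : Type} {F : set_system T} {FF : Filter F} (f : T -> R[i])
    z :
  f @ F --> z <-> (fun t => complex.Re (f t)) @ F --> complex.Re z /\
                  (fun t => complex.Im (f t)) @ F --> complex.Im z.
Proof.
split=> [/cvg_normcP h|[/cvgrPdist_lt hr /cvgrPdist_lt hi]].
  split; apply/cvgrPdist_lt => e /h; apply: filterS => t; apply: le_lt_trans.
    by rewrite distrC -raddfB Re_le_normc.
  by rewrite distrC -raddfB Im_le_normc.
apply/cvg_normcP => e e0; have e2 : 0 < e / 2 by rewrite divr_gt0.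
near=> t; apply: le_lt_trans (normc_le_ReIm _) _.
rewrite !raddfB [ltRHS]splitr ltrD// distrC; near: t.
  exact: hr.
exact: hi.
Unshelve. all: by end_near. Qed.

Lemma hausdorff_complex : hausdorff_space R[i].
Proof. by have := @norm_hausdorff _ R[i]. Qed.

Lemma cexp_continuous : continuous (@cexp R).
Proof.
move=> z; have /cvg_complexP[cr ci] : (fun w : R[i] => w) @ z --> z.
  exact: cvg_id.
have ce : (fun w => expR (complex.Re w)) @ z --> expR (complex.Re z).
  exact: (cvg_comp (fun w : R[i] => complex.Re w) expR cr
    (@continuous_expR R _)).
have cc : (fun w => cos (complex.Im w)) @ z --> cos (complex.Im z).
  exact: (cvg_comp (fun w : R[i] => complex.Im w) cos ci (@continuous_cos R _)).
have cs : (fun w => sin (complex.Im w)) @ z --> sin (complex.Im z).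
  exact: (cvg_comp (fun w : R[i] => complex.Im w) sin ci (@continuous_sin R _)).
apply/(@cvg_complexP _ _ (nbhs_filter z)); split.
  exact: (cvgM ce cc).
exact: (cvgM ce cs).
Qed.

(** Modulo 2 pi the argument can be taken in [0, 2 pi); the half above pi is
    reflected to [0, pi], where the cosine is injective. *)
Lemma cos_eq1 (x : R) : cos x = 1 -> exists n : int, x = (pi *+ 2) *~ n.
Proof.
move=> cx.
have p2 : 0 < (pi : R) *+ 2 by rewrite pmulrn_rgt0 // pi_gt0.
pose n := Num.floor (x / (pi *+ 2)); exists n.
have perz m y : cos (y + (pi *+ 2) *~ m) = cos y :> R.
  case: m => m; first exact/periodicn/cosD2pi.
  rewrite NegzE mulrNz.
  by rewrite -[in RHS](subrK ((pi *+ 2) *+ m.+1) y) (periodicn (@cosD2pi R)).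
have /andP[n1 n2] := floor_itv (x / (pi *+ 2)).
rewrite -/n in n1 n2.
pose y := x - (pi *+ 2) *~ n.
have cy : cos y = 1 by rewrite /y -mulrNz perz.
have y0 : 0 <= y by rewrite subr_ge0 -mulrzl -ler_pdivlMr.
have y2 : y < pi *+ 2.
  rewrite /y ltrBlDr -[X in X + _]mulr1z -mulrzDr -mulrzl.
  by rewrite -ltr_pdivrMr// addrC.
suff : y = 0 by move/eqP; rewrite subr_eq0 => /eqP.
have [yp|yp] := leP y pi.
  by apply: cos_inj; rewrite ?in_itv/= ?y0 ?lexx ?pi_ge0 ?yp// cos0.
have : pi *+ 2 - y = 0.
  apply: cos_inj; rewrite ?in_itv/= ?lexx ?pi_ge0// ?cos0.
    by rewrite subr_ge0 ltW//= mulr2n lerBlDr lerD2l ltW.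
  by rewrite addrC cosD2pi cosN.
by move/eqP; rewrite subr_eq0 => /eqP yE; rewrite -yE ltxx in y2.
Qed.

Definition two_pi_i (n : int) : R[i] := 0 +i* ((pi *+ 2) *~ n).

Lemma cexpD2pii (z : R[i]) n : cexp (z + two_pi_i n) = cexp z.
Proof.
case: z => a b; rewrite /cexp /= addr0.
case: n => n; rewrite ?NegzE ?mulrNz.
  by rewrite (periodicn (@cosD2pi R)) (periodicn (@sinD2pi R)).
rewrite -(periodicn (@cosD2pi R) n.+1) -(periodicn (@sinD2pi R) n.+1).
by rewrite subrK.
Qed.

Lemma cexp_eq (z w : R[i]) : cexp z = cexp w -> exists n, z = w + two_pi_i n.
Proof.
case: z w => [a b] [c d]; rewrite /cexp /= => -[hc hs].
have ac : a = c.
  have sq (u v : R) :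
      (expR u * cos v) ^+ 2 + (expR u * sin v) ^+ 2 = expR u ^+ 2.
    by rewrite !exprMn -mulrDr cos2Dsin2 mulr1.
  apply: expR_inj; apply/eqP; rewrite -(@eqrXn2 _ 2) ?expR_ge0//.
  by rewrite -(sq a b) -(sq c d) hc hs.
subst c; have e0 : expR a != 0 by rewrite gt_eqF ?expR_gt0.
have {}hc := mulfI e0 hc; have {}hs := mulfI e0 hs.
have /cos_eq1[n hn] : cos (b - d) = 1.
  by rewrite cosB hc hs -!expr2 cos2Dsin2.
by exists n; apply/eqP; rewrite eq_complex /= addr0 -hn addrC subrK !eqxx.
Qed.

Lemma normc_two_pi_i n : normc (two_pi_i n) = (pi *+ 2) * `|n|%:~R.
Proof.
rewrite /= expr0n add0r sqrtr_sqr -mulrzl normrM mulrC intr_norm ger0_norm//.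
by rewrite mulrn_wge0 ?pi_ge0.
Qed.
End Complex.

(** * Uniform approximation and closed function algebras *)

Section FunctionAlgebras.
Context {R : realType} {X : topologicalType}.
Implicit Types (A : set (X -> R[i])) (f g : X -> R[i]).

Lemma uniform_closureP A f :
  closure (A : set {uniform X -> R[i]}) f <->
  forall e : R, 0 < e -> exists2 g, A g & forall x, normc (f x - g x) <= e.
Proof.
split=> [cf e e0|h B /uniform_nbhs[E [+ EB]]].
  have e0' : (0 : R[i]) < e%:C by rewrite ltcR.
  have [|g [Ag /= hg]] := cf [set h | forall y, ball (f y) e%:C (h y)].
    apply/uniform_nbhs; exists [set xy | ball xy.1 e%:C xy.2].
    by split; [exact: entourage_ball (PosNum e0')|move=> h hh y; exact: hh].
  exists g => // x; have := hg x.
  by rewrite -ball_normE /ball_/= normcE ltcR => /ltW.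
rewrite -entourage_ballE => -[[e e'] /= + eE].
rewrite ltcE /= => /andP[/eqP e'0 e0]; subst e'.
have [|g Ag fg] := h (e / 2); first by rewrite divr_gt0.
exists g; split => //.
apply: EB => y _; apply: eE => /=; rewrite -ball_normE /ball_/= normcE ltcR.
by apply: le_lt_trans (fg y) _; rewrite ltr_pdivrMr// ltr_pMr// ltr1n.
Qed.

Lemma uniform_closedP A :
  closed (A : set {uniform X -> R[i]}) <->
  forall f, (forall e : R, 0 < e ->
    exists2 g, A g & forall x, normc (f x - g x) <= e) -> A f.
Proof.
split=> [cA f /uniform_closureP/cA//|h f /uniform_closureP]; exact: h.
Qed.

Lemma uniform_closure_closed A f :
  (forall e : R, 0 < e ->
     exists2 g, closure (A : set {uniform X -> R[i]}) g &
       forall x, normc (f x - g x) <= e) ->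
  closure (A : set {uniform X -> R[i]}) f.
Proof.
have /uniform_closedP := @closed_closure {uniform X -> R[i]} A.
exact.
Qed.

Lemma continuous_uniform_closure A f :
  (forall g, A g -> continuous g) ->
  closure (A : set {uniform X -> R[i]}) f -> continuous f.
Proof.
move=> cA /uniform_closureP h x.
apply/(@cvg_normcP _ _ _ (nbhs_filter x)) => e e0.
have e3 : 0 < e / 3 by rewrite divr_gt0.
have [g Ag fg] := h _ e3.
have /(@cvg_normcP _ _ _ (nbhs_filter x))/(_ _ e3) := cA _ Ag x.
apply: filterS => t gt.
have -> : f t - f x = (f t - g t) + (g t - g x) + (g x - f x) by ring.
have := le_normcD (f t - g t + (g t - g x)) (g x - f x).
have := le_normcD (f t - g t) (g t - g x).
have := fg t; have := fg x; rewrite (normc_sub (f x)); lra.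
Qed.

Definition unital_closed_subalgebra A :=
  closed_subalgebra A /\ forall c : R[i], A (cst c).

Section Theory.
Context {A : set (X -> R[i])} (UA : unital_closed_subalgebra A).

Lemma subalg_cst c : A (cst c). Proof. exact: UA.2. Qed.

Lemma subalg0 : A 0. Proof. by have [[[]]] := UA. Qed.

Lemma subalg1 : A 1. Proof. exact: (subalg_cst 1). Qed.

Lemma subalgD f g : A f -> A g -> A (f + g).
Proof. by have [[[_ h _ _] _ _] _] := UA; exact: h. Qed.

Lemma subalgZ c f : A f -> A (c *: f).
Proof. by have [[[_ _ h _] _ _] _] := UA; exact: h. Qed.

Lemma subalgM f g : A f -> A g -> A (f * g).
Proof. by have [[[_ _ _ h] _ _] _] := UA; exact: h. Qed.

Lemma subalgN f : A f -> A (- f).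
Proof. by move=> Af; rewrite -scaleN1r; exact: subalgZ. Qed.

Lemma subalgB f g : A f -> A g -> A (f - g).
Proof. by move=> Af Ag; exact/subalgD/subalgN. Qed.

Lemma subalg_prod (I : eqType) (s : seq I) (F : I -> X -> R[i]) :
  {in s, forall i, A (F i)} -> A (\prod_(i <- s) F i).
Proof.
move=> AF; rewrite big_seq; apply: (big_ind A) => //.
- exact: subalg1.
- by move=> f g; exact: subalgM.
Qed.

Lemma subalg_continuous f : A f -> continuous f.
Proof. by have [[_ h _] _] := UA; exact: h. Qed.

Lemma subalg_closed f : (forall e : R, 0 < e ->
    exists2 g, A g & forall x, normc (f x - g x) <= e) -> A f.
Proof. by have [[_ _ /uniform_closedP h] _] := UA; exact: h. Qed.

(** The partial sums of the geometric series of g lie in A and approximate the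
    pointwise inverse of 1 - g uniformly. *)
Lemma neumann (r : R) g : r < 1 -> A g -> (forall x, normc (g x) <= r) ->
  exists2 h, A h & (1 - g) * h = 1.
Proof.
move=> r1 Ag gr.
have n1 x : 1 - r <= normc (1 - g x).
  have := le_normcD (1 - g x) (g x); rewrite subrK normc1.
  have := gr x; lra.
have n0 x : 1 - g x != 0.
  apply/eqP => e; have := n1 x; rewrite e normc0; lra.
exists (fun x => (1 - g x)^-1); last first.
  by apply/funext => x; rewrite -[LHS]/((1 - g x) * (1 - g x)^-1) divff.
apply: subalg_closed => e e0.
pose s n : X -> R[i] := iter n (fun h => 1 + g * h) 0.
have As n : A (s n).
  elim: n => [|n IH]; first exact: subalg0.
  by apply: subalgD; [exact: subalg1|exact: subalgM].
have sE n x : s n x = (1 - g x ^+ n) / (1 - g x).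
  elim: n => [|n IH]; first by rewrite expr0 subrr mul0r.
  rewrite -[LHS]/(1 + g x * s n x) IH exprS; field; exact: n0.
case: (pselect (exists x : X, True)) => [[x0 _]|nX]; last first.
  by exists 0; [exact: subalg0|move=> x; case: nX; exists x].
have r0 : 0 <= r := le_trans (normc_ge0 _) (gr x0).
have r1' : 0 < 1 - r by rewrite subr_gt0.
have : (fun n => r ^+ n) @ \oo --> 0 by apply: cvg_expr; rewrite ger0_norm.
move=> /cvgrPdist_lt/(_ _ (mulr_gt0 e0 r1'))[N _ /(_ N (leqnn N))] /=.
rewrite sub0r normrN ger0_norm ?exprn_ge0// => rN.
exists (s N) => // x; rewrite sE.
have -> : (1 - g x)^-1 - (1 - g x ^+ N) / (1 - g x) = g x ^+ N / (1 - g x).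
  by field; exact: n0.
rewrite normcM normcX normcV ler_pdivrMr; last exact: lt_le_trans (n1 x).
apply: le_trans (_ : r ^+ N <= _).
  by rewrite lerXn2r ?nnegrE ?normc_ge0.
by apply: le_trans (ltW rN) _; rewrite ler_pM2l.
Qed.

(** v w = 1 - v (u - w) is invertible by the geometric series. *)
Lemma invertibles_open u w v (M : R) : A u -> A w -> A v -> u * v = 1 ->
  (forall x, normc (v x) <= M) ->
  (forall x, normc (u x - w x) * M <= 2^-1) -> invertibles A w.
Proof.
move=> Au Aw Av uv vM uw; split => //.
have [||x|h Ah hE] := @neumann 2^-1 (v * (u - w)).
- by rewrite invf_lt1 ?ltr1n.
- exact/subalgM/subalgB.
- rewrite -[X in normc X]/(v x * (u x - w x)) normcM mulrC.
  apply: le_trans (uw x); rewrite ler_wpM2l ?normc_ge0//.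
exists (v * h); first exact: subalgM.
by rewrite -hE mulrBr (mulrC v u) uv; ring.
Qed.
End Theory.
End FunctionAlgebras.

(** * Convergence in initial and product topologies *)

Section Convergence.

Lemma cvg_initial {S : choiceType} {T : topologicalType} (f : S -> T)
    (F : set_system S) (s : S) : Filter F ->
  (f @ F --> f s) -> F --> (s : initial_topology f).
Proof.
move=> FF cf B [C [[D oD <-] Ds DB]].
apply: filterS DB _; apply: (cf D); exact: open_nbhs_nbhs.
Qed.

Lemma cvg_set_type {T : topologicalType} (K : set T)
    (F : set_system K) (s : K) :
  Filter F -> (set_val @ F --> set_val s) -> F --> s.
Proof. exact: cvg_initial. Qed.

Lemma set_val_continuous {T : topologicalType} (K : set T) :
  continuous (set_val : K -> T).
Proof. exact: initial_continuous. Qed.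

Lemma cvg_prod_topology {I : choiceType} {T : I -> topologicalType}
    (F : set_system (prod_topology T)) (f : prod_topology T) : Filter F ->
  (forall i, (fun g : prod_topology T => g i) @ F --> f i) -> F --> f.
Proof. by move=> FF cf; apply/cvg_sup => i; apply: cvg_initial; exact: cf. Qed.

(** Serves both for character spaces, which their elements separate, and for
    the space of the logarithmic extension. *)
Lemma hausdorff_separated (R : realType) (T : topologicalType) :
  (forall x y : T, x <> y ->
     exists2 f : T -> R[i], continuous f & f x <> f y) ->
  hausdorff_space T.
Proof.
move=> sep p q cl; apply: contrapT => /sep[f cf]; apply.
apply: (@hausdorff_complex R) => U V /cf Up /cf Vq.
by have [z [Uz Vz]] := cl _ _ Up Vq; exists (f z).
Qed.

Lemma ultra_compact_cvg {T U : topologicalType} (F : set_system T) (f : T -> U)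
    (K : set U) : UltraFilter F -> compact K -> (\forall t \near F, K (f t)) ->
  exists2 x, K x & f @ F --> x.
Proof.
move=> FF cK FK.
have [x [Kx clx]] := cK (f @ F) _ FK.
exists x => // B; rewrite nbhsE => -[C [oC Cx] CB].
have [FC|FC] := in_ultra_setVsetC (f @^-1` C) FF.
  by apply: filterS FC => t /CB.
have [||y []//] := clx (~` C) C; first exact: FC.
by apply: open_nbhs_nbhs; split.
Qed.

End Convergence.

(** * Characters of a function algebra *)

Section Characters.
Context {R : realType} {X : topologicalType} {A : set (X -> R[i])}.
Implicit Types (f g : X -> R[i]) (phi : A -> R[i]).

Definition subalg_elt f (Af : A f) : A := SigSub (mem_set Af).

(** Totalising a character to all functions turns its morphism laws, which
    relate three elements of the subtype, into plain equations between
    functions, so that they can be used by rewriting. *)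
Definition extend_character phi f : R[i] :=
  if pselect (A f) is left Af then phi (subalg_elt Af) else 0.

Lemma extend_characterE phi (a : A) : extend_character phi (set_val a) = phi a.
Proof.
rewrite /extend_character; case: pselect => [Aa|].
  by congr phi; apply: val_inj.
by case; exact: set_valP.
Qed.

Lemma extend_character_in phi f (Af : A f) :
  extend_character phi f = phi (subalg_elt Af).
Proof. by rewrite -extend_characterE. Qed.

Section OneCharacter.
Context (UA : unital_closed_subalgebra A) {phi : A -> R[i]}
        (cphi : is_character phi).
Let psi := extend_character phi.

Lemma characterD f g : A f -> A g -> psi (f + g) = psi f + psi g.
Proof.
move=> Af Ag; have [h _ _ _] := cphi.
rewrite /psi !(extend_character_in _ Af) (extend_character_in _ Ag).
by rewrite (extend_character_in _ (subalgD UA Af Ag)); exact: h.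
Qed.

Lemma characterZ c f : A f -> psi (c *: f) = c * psi f.
Proof.
move=> Af; have [_ h _ _] := cphi.
rewrite /psi !(extend_character_in _ Af).
by rewrite (extend_character_in _ (subalgZ UA c Af)); exact: h.
Qed.

Lemma characterM f g : A f -> A g -> psi (f * g) = psi f * psi g.
Proof.
move=> Af Ag; have [_ _ h _] := cphi.
rewrite /psi !(extend_character_in _ Af) (extend_character_in _ Ag).
by rewrite (extend_character_in _ (subalgM UA Af Ag)); exact: h.
Qed.

Lemma character1 : psi 1 = 1.
Proof.
have [_ _ _ [a /eqP a0]] := cphi.
have := characterM (set_valP a) (subalg1 UA).
rewrite mulr1 /psi extend_characterE -[X in X = _]mulr1 => /(mulfI a0).
exact: esym.
Qed.

Lemma character_cst c : psi (cst c) = c.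
Proof.
have -> : cst c = c *: (1 : X -> R[i]) by apply/funext => x; exact/esym/mulr1.
by rewrite characterZ ?character1 ?mulr1//; exact: subalg1.
Qed.

Lemma character0 : psi 0 = 0. Proof. exact: (character_cst 0). Qed.

Lemma characterN f : A f -> psi (- f) = - psi f.
Proof. by move=> Af; rewrite -scaleN1r characterZ// mulN1r. Qed.

Lemma characterB f g : A f -> A g -> psi (f - g) = psi f - psi g.
Proof.
by move=> Af Ag; rewrite characterD// ?characterN//; exact: subalgN.
Qed.

Lemma character_prod (I : eqType) (s : seq I) (F : I -> X -> R[i]) :
  {in s, forall i, A (F i)} ->
  psi (\prod_(i <- s) F i) = \prod_(i <- s) psi (F i).
Proof.
elim: s => [|i s IH] AF; first by rewrite !big_nil character1.
have As : {in s, forall i, A (F i)}.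
  by move=> j js; apply: AF; rewrite inE js orbT.
rewrite !big_cons characterM ?IH//; first by apply: AF; rewrite mem_head.
exact: subalg_prod.
Qed.

(** If phi f had modulus larger than r, then 1 - f / phi f would be invertible
    by the geometric series although phi maps it to 0. *)
Lemma character_bound (r : R) f : A f -> (forall x, normc (f x) <= r) ->
  normc (psi f) <= r.
Proof.
move=> Af fr; rewrite leNgt; apply/negP => rl.
have [r0|r0] := ltP r 0.
  (* A negative bound forces the space to be empty, so that 1 = 0. *)
  have : psi 1 = psi 0.
    congr psi; apply/funext => x; exfalso.
    have := fr x; have := normc_ge0 (f x); lra.
  by rewrite character1 character0 => /eqP; rewrite oner_eq0.
have p0 : 0 < normc (psi f) by exact: le_lt_trans rl.
have pf0 : psi f != 0 by apply: contraTneq p0 => ->; rewrite normc0 ltxx.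
have Ag := subalgZ UA (psi f)^-1 Af.
have [||h Ah] := @neumann _ _ _ UA (r / normc (psi f)) _ _ Ag.
- by rewrite ltr_pdivrMr// mul1r.
- move=> x; rewrite -[X in normc X]/((psi f)^-1 * f x) normcM normcV mulrC.
  by rewrite ler_pM2r ?invr_gt0.
have A1 := subalg1 UA.
move/(congr1 psi); rewrite characterM ?character1//; last exact: subalgB.
rewrite characterB// characterZ// mulVf// character1 subrr mul0r => /eqP.
by rewrite eq_sym oner_eq0.
Qed.

End OneCharacter.

Definition is_evaluation phi (x : X) := forall a : A, phi a = set_val a x.

Context (UA : uniform_algebra A).

Lemma uniform_algebra_unital : unital_closed_subalgebra A.
Proof. by split; [exact: ua_closed_subalgebra|exact: ua_constants]. Qed.

Let UAu := uniform_algebra_unital.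

Lemma evaluation_is_character (x : X) :
  is_character (fun a : A => set_val a x).
Proof.
split.
- by move=> f g h ->.
- by move=> c f h ->.
- by move=> f g h ->.
- by exists (subalg_elt (subalg1 UAu)); apply/eqP; exact: oner_neq0.
Qed.

Definition evaluation (x : X) : character_space A :=
  SigSub (mem_set (evaluation_is_character x)).

Lemma gelfand_continuous (a : A) : continuous (gelfand a).
Proof.
move=> w; apply: (@continuous_comp _ _ _ set_val
  (fun g : prod_topology (fun _ : A => R[i]) => g a)).
  exact: set_val_continuous.
exact: (@proj_continuous _ (fun _ : A => R[i])).
Qed.

Lemma character_space_hausdorff : hausdorff_space (character_space A).
Proof.
apply: (@hausdorff_separated R) => v w vw; apply: contrapT => h; apply: vw.
apply: val_inj; apply/funext => a; apply: contrapT => av; apply: h.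
by exists (gelfand a) => //; exact: gelfand_continuous.
Qed.

Lemma evaluation_continuous : continuous evaluation.
Proof.
move=> x; apply: cvg_set_type; apply: cvg_prod_topology => a.
exact: (subalg_continuous UAu (set_valP a)).
Qed.

(** The evaluations are a continuous image of a compact space in a Hausdorff
    one. *)
Lemma evaluation_closed (E : set X) : closed E -> closed (evaluation @` E).
Proof.
move=> cE; apply: compact_closed; first exact: character_space_hausdorff.
apply: continuous_compact.
  by apply: continuous_subspaceT; exact: evaluation_continuous.
exact: subclosed_compact cE (ua_compact UA) _.
Qed.

Section Regular.
Context (RA : regular A).

(** Otherwise regularity yields an element that vanishes at all evaluations,
    that is, the zero function, and has Gelfand transform 1 at phi. *)
Lemma regular_natural phi : is_character phi -> exists x, is_evaluation phi x.
Proof.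
move=> cphi; apply: contrapT => nx.
pose w : character_space A := SigSub (mem_set cphi).
have [|[x _ xw]|a [a0 wa]] := RA (E := evaluation @` setT) (omega := w).
- exact/evaluation_closed/closedT.
- by apply: nx; exists x => a; rewrite -[phi]/(set_val w) -xw.
have ax x : set_val a x = 0.
  by apply: a0; exists (evaluation x) => //; exists x.
have a00 : set_val a = 0 by apply/funext.
have : phi a = 0 by rewrite -extend_characterE a00 (character0 UAu cphi).
by move/eqP; rewrite -[phi a]/(gelfand a w) wa oner_eq0.
Qed.

Lemma regular_bump (E : set X) (x : X) : closed E -> ~ E x ->
  exists f, [/\ A f, f x = 1 & forall y, E y -> f y = 0].
Proof.
move=> cE nEx.
have [|[y Ey yx]|a [a0 wa]] :=
  RA (E := evaluation @` E) (omega := evaluation x).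
- exact: evaluation_closed.
- suff yx' : y = x by rewrite yx' in Ey.
  apply: contrapT => /(ua_separates_points UA)[f Af]; apply.
  by rewrite -[f y]/(set_val (evaluation y) (subalg_elt Af)) yx.
exists (set_val a); split => //; first exact: set_valP.
by move=> y Ey; apply: a0; exists (evaluation y) => //; exists y.
Qed.

End Regular.
End Characters.

(** * Generated subalgebras and simultaneous perturbation *)

Section ClosedSubalgebras.
Context {R : realType} {X : topologicalType}.
Implicit Types (A : set (X -> R[i])) (f g : X -> R[i]).

Lemma continuous_functions_subalgebra :
  subalgebra [set f : X -> R[i] | continuous f].
Proof.
split=> /=.
- by move=> x; exact: cvg_cst.
- by move=> f g cf cg x; exact: (cvgD (cf x) (cg x)).
- by move=> c f cf x; exact: (cvgM (cvg_cst c) (cf x)).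
- by move=> f g cf cg x; exact: (cvgM (cf x) (cg x)).
Qed.

Lemma continuous_functions_closed_subalgebra :
  closed_subalgebra [set f : X -> R[i] | continuous f].
Proof.
split.
- exact: continuous_functions_subalgebra.
- by move=> f; exact.
- move=> f.
  by apply: (@continuous_uniform_closure _ _ [set g : X -> R[i] | continuous g]).
Qed.

Lemma generated_closed_subalgebraP (F : set (X -> R[i])) :
  (forall f, F f -> continuous f) ->
  closed_subalgebra (generated_closed_subalgebra F).
Proof.
move=> cF; split; first split.
- by move=> B [[[]]].
- move=> f g Bf Bg B BP; have [[[_ h _ _] _ _] _] := BP.
  by apply: h; [exact: Bf|exact: Bg].
- by move=> c f Bf B BP; have [[[_ _ h _] _ _] _] := BP; apply: h; exact: Bf.
- move=> f g Bf Bg B BP; have [[[_ _ _ h] _ _] _] := BP.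
  by apply: h; [exact: Bf|exact: Bg].
- move=> f Bf; apply: (Bf [set g : X -> R[i] | continuous g]); split=> [|g].
    exact: continuous_functions_closed_subalgebra.
  exact: cF.
- apply/uniform_closedP => f hf B BP; have [[_ _ /uniform_closedP h] _] := BP.
  apply: h => e e0; have [g Bg fg] := hf _ e0.
  by exists g; [exact: Bg|exact: fg].
Qed.

Lemma compact_continuous_bounded f : compact [set: X] -> continuous f ->
  exists2 M : R, 0 < M & forall x, normc (f x) <= M.
Proof.
move=> cX cf.
have cn : continuous (fun x => normc (f x) : R^o).
  move=> x; apply/cvgrPdist_lt => e e0.
  have /(@cvg_normcP _ _ _ (nbhs_filter x))/(_ _ e0) := cf x.
  apply: filterS => t; apply: le_lt_trans.
  have := le_normcD (f t - f x) (f x); have := le_normcD (f x - f t) (f t).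
  rewrite !subrK (normc_sub (f x)) ler_norml; lra.
have /compact_bounded : compact ((fun x => normc (f x) : R^o) @` setT).
  by apply: continuous_compact => //; exact: continuous_subspaceT.
move=> /pinfty_ex_gt0[M M0 hM]; exists M => // x.
have := hM (normc (f x)) (imageP _ I).
by rewrite /= ger0_norm// normc_ge0.
Qed.

(** Continuous functions on a compact space are bounded, so products of uniform
    limits are uniform limits of products. *)
Lemma uniform_closure_subalgebra A : compact [set: X] -> subalgebra A ->
  (forall f, A f -> continuous f) ->
  closed_subalgebra (closure (A : set {uniform X -> R[i]})).
Proof.
move=> cX [A0 AD AZ AM] cA; split; last exact: closed_closure.
- split.
  + exact: subset_closure.
  + move=> f g /uniform_closureP hf /uniform_closureP hg.
    apply/uniform_closureP => e e0; have e2 : 0 < e / 2 by rewrite divr_gt0.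
    have [f' Af ff'] := hf _ e2; have [g' Ag gg'] := hg _ e2.
    exists (f' + g'); first exact: AD.
    move=> x; rewrite -[X in normc X]/((f x + g x) - (f' x + g' x)).
    rewrite opprD addrACA; apply: le_trans (le_normcD _ _) _.
    by rewrite [leRHS]splitr lerD.
  + move=> c f /uniform_closureP hf; apply/uniform_closureP => e e0.
    have c0 : 0 < normc c + 1 by rewrite ltr_wpDl// normc_ge0.
    have [f' Af ff'] := hf _ (divr_gt0 e0 c0).
    exists (c *: f'); first exact: AZ.
    move=> x; rewrite -[X in normc X]/(c * f x - c * f' x) -mulrBr normcM.
    apply: le_trans (_ : (normc c + 1) * (e / (normc c + 1)) <= _).
      by rewrite ler_pM ?normc_ge0// lerDl.
    by rewrite mulrC divfK// gt_eqF.
  + move=> f g /[dup] cf /uniform_closureP hf cg.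
    have [M M0 fM] :=
      compact_continuous_bounded cX (continuous_uniform_closure cA cf).
    apply: uniform_closure_closed => e e0.
    have [g' Ag' gg'] := (uniform_closureP _ _).1 cg _ (divr_gt0 e0 M0).
    exists (f * g').
      apply/uniform_closureP => d d0.
      have [N N0 gN] := compact_continuous_bounded cX (cA _ Ag').
      have [f' Af' ff'] := hf _ (divr_gt0 d0 N0).
      exists (f' * g'); first exact: AM.
      move=> x; rewrite -[X in normc X]/(f x * g' x - f' x * g' x).
      rewrite -mulrBl normcM.
      apply: le_trans (_ : d / N * N <= _); last by rewrite divfK// gt_eqF.
      by rewrite ler_pM ?normc_ge0.
    move=> x; rewrite -[X in normc X]/(f x * g x - f x * g' x) -mulrBr normcM.
    apply: le_trans (_ : M * (e / M) <= _).
      by rewrite ler_pM ?normc_ge0.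
    by rewrite mulrC divfK// gt_eqF.
- by move=> f; exact: continuous_uniform_closure.
Qed.

(** Each condition on h describes a dense open subset of A, and a finite
    intersection of dense open sets is dense. *)
Lemma shift_all_invertible A (L : seq (X -> R[i])) (e : R) :
  compact [set: X] -> unital_closed_subalgebra A -> invertibles_dense A ->
  {in L, forall F, A F} -> 0 < e ->
  exists h, [/\ A h, forall x, normc (h x) <= e &
    {in L, forall F, invertibles A (F - h)}].
Proof.
move=> cX UA dA AL e0.
(* The induction needs some room around h: adding one more condition moves h
   slightly, and the conditions already met have to survive. *)
suff [h [Ah he [d d0 hd]]] : exists h, [/\ A h, forall x, normc (h x) <= e &
    exists2 d : R, 0 < d &
    forall k, A k -> (forall x, normc (k x - h x) <= d) ->
    {in L, forall F, invertibles A (F - k)}].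
  by exists h; split=> //; apply: hd => // x; rewrite subrr normc0 ltW.
elim: L e AL e0 => [|F L IH] e AL e0.
  exists 0; split; first exact: (subalg0 UA).
    by move=> x; rewrite normc0 ltW.
  by exists 1.
have e2 : 0 < e / 2 by rewrite divr_gt0.
have [|h0 [Ah0 h0e [d d0 hd]]] := IH _ _ e2.
  by move=> G GL; apply: AL; rewrite inE GL orbT.
have AF : A F by apply: AL; rewrite mem_head.
pose d' := Num.min (d / 2) (e / 2).
have d'0 : 0 < d' by rewrite lt_min e2 divr_gt0.
have d'd : d' <= d / 2 by rewrite ge_min lexx.
have d'e : d' <= e / 2 by rewrite ge_min lexx orbT.
have [u [Au [v Av uv]] ud] :=
  (uniform_closureP _ _).1 (dA _ (subalgB UA AF Ah0)) _ d'0.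
have [M M0 vM] := compact_continuous_bounded cX (subalg_continuous UA Av).
have hE x : (F - u) x - h0 x = (F - h0) x - u x.
  by rewrite -[LHS]/((F x - u x) - h0 x) addrAC.
exists (F - u); split; first exact: subalgB.
- move=> x; have := ud x; rewrite -hE; have := h0e x.
  have := le_normcD ((F - u) x - h0 x) (h0 x); rewrite subrK.
  lra.
- exists (Num.min (d / 2) (2^-1 / M)).
    by rewrite lt_min !divr_gt0// invr_gt0.
  move=> k Ak kd G; rewrite inE => /orP[/eqP ->|]; last first.
    move: G; apply: hd => // x; have := ud x; rewrite -hE => h1.
    have := kd x; rewrite le_min => /andP[h2 _].
    have := le_normcD (k x - (F - u) x) ((F - u) x - h0 x).
    rewrite addrA subrK; lra.
  apply: (@invertibles_open _ _ _ UA u _ v M) => //; first exact: subalgB.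
  move=> x; have := kd x; rewrite le_min => /andP[_].
  rewrite ler_pdivlMr//; congr (normc _ * _ <= _).
  by rewrite -[LHS]/(k x - (F x - u x)) -[RHS]/(u x - (F x - k x)); ring.
Qed.

End ClosedSubalgebras.

(** * The space of the logarithmic extension *)

Section LogSpace.
Context {R : realType} {Omega : topologicalType}.
Context {t : (Omega -> R[i]) -> R} {S : set (Omega -> R[i])}.
Let Y := log_space t S.
Let proj : Y -> Omega := @log_proj R Omega t S.
Let coord : S -> Y -> R[i] := @log_coord R Omega t S.

Lemma log_proj_continuous : continuous proj.
Proof.
move=> y; apply: (@continuous_comp _ _ _ set_val fst).
  exact: set_val_continuous.
exact: cvg_fst.
Qed.

Lemma log_coord_continuous (a : S) : continuous (coord a).
Proof.
move=> y; apply: (@continuous_comp _ _ _ (fun y : Y => (set_val y).2)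
  (fun g : prod_topology (fun _ : S => R[i]) => g a)).
  apply: (@continuous_comp _ _ _ set_val snd); first exact: set_val_continuous.
  exact: cvg_snd.
exact: (@proj_continuous _ (fun _ : S => R[i])).
Qed.

Lemma log_space_cvg (F : set_system Y) (y : Y) : Filter F ->
  proj @ F --> proj y -> (forall a, coord a @ F --> coord a y) -> F --> y.
Proof.
move=> FF cproj ccoord; apply: cvg_set_type.
have -> : (set_val : Y -> _) = (fun z => (proj z, (set_val z).2)).
  by apply/funext => z; rewrite [LHS]surjective_pairing.
rewrite [set_val y]surjective_pairing.
have c2 : (fun z : Y => (set_val z).2) @ F --> (set_val y).2.
  by apply: cvg_prod_topology => a; exact: (ccoord a).
exact: (cvg_pair cproj c2).
Qed.

Lemma log_space_eq (y z : Y) :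
  proj y = proj z -> (forall a, coord a y = coord a z) -> y = z.
Proof.
move=> e1 e2; apply: val_inj; rewrite /= [LHS]surjective_pairing.
by rewrite [RHS]surjective_pairing; congr pair => //; apply/funext.
Qed.

Lemma log_coord_bound (a : S) y : normc (coord a y) <= t (set_val a).
Proof. by have [+ _] := set_valP y a; rewrite normcE lecR. Qed.

Lemma cexp_log_coord (a : S) y : cexp (coord a y) = set_val a (proj y).
Proof. by have [_] := set_valP y a. Qed.

Definition log_point (x : Omega) (l : S -> R[i])
  (h : log_set t S (x, l)) : Y := SigSub (mem_set h).

(** Along an ultrafilter the projection converges by compactness of the base
    and each coordinate by boundedness; the equation exp p_a = a and the bound
    on p_a pass to the limit, which is therefore a point of the space. *)
Lemma log_space_compact : compact [set: Omega] ->
  (forall a : S, continuous (set_val a)) -> compact [set: Y].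
Proof.
move=> cO cS; rewrite compact_ultra => F FF _.
have [x _ Fx] := @ultra_compact_cvg _ _ F proj _ FF cO filterT.
have lim (a : S) : exists l : R[i], coord a @ F --> l.
  have part (f : R[i] -> R) : (forall z, `|f z| <= normc z) ->
      exists u : R, (fun y => f (coord a y)) @ F --> u.
    move=> fz.
    have [|u _ Fu] := @ultra_compact_cvg _ _ F (fun y => f (coord a y)) _ FF
      (@segment_compact R (- t (set_val a)) (t (set_val a))).
      apply: filterE => y; rewrite /= in_itv /= -ler_norml.
      exact: le_trans (fz _) (log_coord_bound _ _).
    by exists u.
  have [u Fu] := part _ (@Re_le_normc R).
  have [v Fv] := part _ (@Im_le_normc R).
  by exists (u +i* v); apply/cvg_complexP.
have [l Fl] := choice lim.
have hl : log_set t S (x, l).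
  move=> a /=; split.
    rewrite normcE lecR leNgt; apply/negP => tl.
    have := (@cvg_normcP _ _ F _ _ _).1 (Fl a) (normc (l a) - t (set_val a)).
    rewrite subr_gt0 => /(_ _ tl)/filter_ex[y].
    have := log_coord_bound a y.
    have := le_normcD (l a - coord a y) (coord a y).
    rewrite subrK (normc_sub (l a)); lra.
  have h1 : (fun y => cexp (coord a y)) @ F --> cexp (l a).
    exact: (cvg_comp (coord a) (@cexp R) (Fl a) (@cexp_continuous R _)).
  have h2 : (fun y => cexp (coord a y)) @ F --> set_val a x.
    have -> : (fun y => cexp (coord a y)) = set_val a \o proj.
      by apply/funext => y; exact: cexp_log_coord.
    exact: (cvg_comp proj (set_val a) Fx (cS a x)).
  by apply: (cvg_unique _ h1 h2); exact: hausdorff_complex.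
by exists (log_point hl); split => //; apply: log_space_cvg.
Qed.

End LogSpace.

(** * Finitely branched functions over a base space *)

(** The list does not depend on the point, so that g is a root of the monic
    polynomial prod_(F <- L) (z - F) over A. *)
Definition finitely_branched (R : realType) (X Y : Type) (pi : Y -> X)
    (A : set (X -> R[i])) (g : Y -> R[i]) :=
  exists L : seq (X -> R[i]), {in L, forall F, A F} /\
    forall y, exists2 F, F \in L & g y = F (pi y).

(** This filter converges to y exactly when functions of B separate y from
    every closed set that misses it. *)
Definition zero_neighbourhoods (R : realType) (Y : Type)
    (B : set (Y -> R[i])) (y : Y) : set_system Y :=
  [set U | exists b, [/\ B b, b y <> 0 & forall z, ~ U z -> b z = 0]].

Section Branched.
Context {R : realType} {X Y : topologicalType} (pi : Y -> X).
Context {A : set (X -> R[i])} {B : set (Y -> R[i])}.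
Context (UA : unital_closed_subalgebra A) (UB : unital_closed_subalgebra B).
Context (AB : forall f, A f -> B (f \o pi)).
Implicit Types (f F h : X -> R[i]) (g : Y -> R[i]) (L : seq (X -> R[i])).

Lemma finitely_branched_subalgebra :
  subalgebra [set g | B g /\ finitely_branched pi A g].
Proof.
split.
- split; first exact: subalg0.
  exists [:: 0]; split=> [F|y]; first by rewrite inE => /eqP ->; exact: subalg0.
  by exists 0; rewrite ?mem_head.
- move=> g g' [Bg [L [AL gL]]] [Bg' [L' [AL' gL']]].
  split; first exact: subalgD.
  exists [seq F + F' | F <- L, F' <- L']; split=> [G|y].
    move=> /allpairsP[[F F'] /= [FL FL' ->]].
    by apply: subalgD => //; [exact: AL|exact: AL'].
  have [F FL gF] := gL y; have [F' FL' gF'] := gL' y.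
  by exists (F + F'); [exact: allpairs_f|rewrite fctE gF gF'].
- move=> c g [Bg [L [AL gL]]]; split; first exact: subalgZ.
  exists [seq c *: F | F <- L]; split=> [_ /mapP[F FL ->]|y].
    by apply: subalgZ => //; exact: AL.
  have [F FL gF] := gL y.
  by exists (c *: F); [exact: map_f|rewrite -[LHS]/(c * g y) gF].
- move=> g g' [Bg [L [AL gL]]] [Bg' [L' [AL' gL']]].
  split; first exact: subalgM.
  exists [seq F * F' | F <- L, F' <- L']; split=> [G|y].
    move=> /allpairsP[[F F'] /= [FL FL' ->]].
    by apply: subalgM => //; [exact: AL|exact: AL'].
  have [F FL gF] := gL y; have [F' FL' gF'] := gL' y.
  by exists (F * F'); [exact: allpairs_f|rewrite fctE gF gF'].
Qed.

Lemma prod_branches_eq0 L g y :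
  (exists2 F, F \in L & g y = F (pi y)) ->
  (\prod_(F <- L) (g - (F \o pi))) y = 0.
Proof.
move=> [F FL gF]; rewrite fct_prodE; apply/eqP; rewrite prodf_seq_eq0.
apply/hasP; exists F => //=.
by rewrite -[X in X == _]/(g y - F (pi y)) gF subrr.
Qed.

Lemma prod_branches_in L g : B g -> {in L, forall F, A F} ->
  B (\prod_(F <- L) (g - (F \o pi))).
Proof.
move=> Bg AL; apply: subalg_prod => // F FL.
by apply: subalgB => //; exact/AB/AL.
Qed.

(** P(g) - P(h) is divisible by g - h, for P(z) = prod_(F <- L) (z - F). *)
Lemma prod_branches_remainder L g h : B g -> A h -> {in L, forall F, A F} ->
  exists2 q, B q & \prod_(F <- L) (g - (F \o pi)) =
    (g - (h \o pi)) * q + ((\prod_(F <- L) (h - F)) \o pi).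
Proof.
move=> Bg Ah; elim: L => [|F L IH] AL.
  by exists 0; [exact: subalg0|rewrite !big_nil mulr0 add0r].
have ALs : {in L, forall F, A F}.
  by move=> G GL; apply: AL; rewrite inE GL orbT.
have AF : A F by apply: AL; rewrite mem_head.
have [q Bq qE] := IH ALs.
have AP : A (\prod_(F <- L) (h - F)).
  by apply: subalg_prod => // G GL; apply: subalgB => //; exact: ALs.
exists ((g - (F \o pi)) * q + ((\prod_(F <- L) (h - F)) \o pi)).
  apply: subalgD => //; last exact: AB.
  by apply: subalgM => //; apply: subalgB => //; exact: AB.
rewrite !big_cons qE.
rewrite -[((h - F) * _) \o pi]/
  (((h \o pi) - (F \o pi)) * ((\prod_(F <- L) (h - F)) \o pi)).
ring.
Qed.

Lemma invertibles_prod L h : {in L, forall F, invertibles A (F - h)} ->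
  exists2 v, A v & (\prod_(F <- L) (h - F)) * v = 1.
Proof.
elim: L => [|F L IH] iL.
  by exists 1; [exact: subalg1|rewrite big_nil mulr1].
have [|v Av vE] := IH; first by move=> G GL; apply: iL; rewrite inE GL orbT.
have [_ [w Aw wE]] : invertibles A (F - h) by apply: iL; rewrite mem_head.
exists (- w * v); first by apply: subalgM => //; exact: subalgN.
by rewrite big_cons mulrACA vE mulr1 -wE; ring.
Qed.

(** As P(g) = 0 for P(z) = prod_(F <- L) (z - F), the function g - h divides
    P(h), a product of invertible functions. *)
Lemma shift_branched_invertible L g h : B g -> A h ->
  {in L, forall F, A F} -> (forall y, exists2 F, F \in L & g y = F (pi y)) ->
  {in L, forall F, invertibles A (F - h)} -> invertibles B (g - (h \o pi)).
Proof.
move=> Bg Ah AL gL iL; split; first by apply: subalgB => //; exact: AB.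
have [q Bq] := prod_branches_remainder Bg Ah AL.
have -> : \prod_(F <- L) (g - (F \o pi)) = 0.
  by apply/funext => y; exact: prod_branches_eq0.
have [v Av vE] := invertibles_prod iL.
set P := \prod_(F <- L) _ in vE * => qE.
exists (- q * (v \o pi)); first by apply: subalgM; [|exact: subalgN|exact: AB].
have vP : (P \o pi) * (v \o pi) = 1 by rewrite -[LHS]/((P * v) \o pi) vE.
rewrite -vP mulrA; congr (_ * _).
by apply/eqP; rewrite mulrN -subr_eq0 -opprD -qE oppr0.
Qed.

(** The product of a bump at x supported in V with all the g - F vanishes
    identically, so phi kills one of its factors, and not the bump.  Only a
    local list of branches is required, which is what allows to tell which
    branches are logarithms at x. *)
Lemma character_in_branches (phi : B -> R[i]) (x : X) (V : set X) L g :
  is_character phi ->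
  (forall f, A f -> extend_character phi (f \o pi) = f x) ->
  (exists f, [/\ A f, f x = 1 & forall z, ~ V z -> f z = 0]) ->
  B g -> {in L, forall F, A F} ->
  (forall y, V (pi y) -> exists2 F, F \in L & g y = F (pi y)) ->
  exists2 F, F \in L & extend_character phi g = F x.
Proof.
move=> cphi phix [f [Af fx fV]] Bg AL gL.
have BP := prod_branches_in Bg AL.
have : extend_character phi ((f \o pi) * \prod_(F <- L) (g - (F \o pi))) = 0.
  rewrite -(character0 UB cphi); congr extend_character; apply/funext => y.
  rewrite -[LHS]/(f (pi y) * (\prod_(F <- L) (g - (F \o pi))) y).
  have [Vy|nV] := pselect (V (pi y)); last by rewrite fV// mul0r.
  by rewrite (prod_branches_eq0 (gL y Vy)) mulr0.
rewrite characterM//; last exact: AB.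
rewrite phix// fx mul1r character_prod//; last first.
  by move=> F FL; apply: subalgB => //; exact/AB/AL.
move/eqP; rewrite prodf_seq_eq0 => /hasP[F FL /= /eqP].
have BF : B (F \o pi) by exact/AB/AL.
rewrite characterB// phix; last exact: AL.
by move/eqP; rewrite subr_eq0 => /eqP e; exists F.
Qed.

Lemma zero_neighbourhoods_filter y : Filter (zero_neighbourhoods B y).
Proof.
split.
- exists 1; split; [exact: subalg1| |by move=> z []].
  by apply/eqP; exact: oner_neq0.
- move=> U V [b [Bb by0 bU]] [c [Bc cy0 cV]]; exists (b * c); split.
  + exact: subalgM.
  + by apply/eqP; rewrite mulf_eq0 negb_or; apply/andP; split; apply/eqP.
  + move=> z UVz; rewrite -[LHS]/(b z * c z).
    have [Uz|nU] := pselect (U z); last by rewrite bU// mul0r.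
    by rewrite (cV z) ?mulr0// => Vz; apply: UVz.
- move=> U V UV [b [Bb by0 bU]]; exists b; split => // z nV.
  by apply: bU => /UV.
Qed.

Context (bump : forall (E : set X) (x : X), closed E -> ~ E x ->
  exists f, [/\ A f, f x = 1 & forall z, E z -> f z = 0]).

Lemma zero_neighbourhoods_proj y : pi @ zero_neighbourhoods B y --> pi y.
Proof.
move=> U; rewrite nbhsE => -[V [oV Vy] VU].
have [|f [Af fy fV]] := bump (open_closedC oV) (x := pi y); first by [].
exists (f \o pi); split; first exact: AB.
- by rewrite /= fy; apply/eqP; exact: oner_neq0.
- by move=> z nU; apply: fV => /VU.
Qed.

Lemma zero_neighbourhoods_branched g y : B g -> finitely_branched pi A g ->
  g @ zero_neighbourhoods B y --> g y.
Proof.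
move=> Bg [L [AL gL]].
have FF := zero_neighbourhoods_filter y.
apply/cvg_normcP => e e0.
(* Close to the projection of y, the branches that pass through g y stay close
   to this value. *)
have near_branch : \forall z \near zero_neighbourhoods B y,
    forall F, F \in L -> F (pi y) = g y -> normc (F (pi z) - g y) < e.
  have : \forall x \near pi y,
      forall F, F \in L -> F (pi y) = g y -> normc (F x - g y) < e.
    elim: L AL {gL} => [|F L IH] AL; first exact: filterE.
    have ALs : {in L, forall F, A F}.
      by move=> G GL; apply: AL; rewrite inE GL orbT.
    have AF : A F by apply: AL; rewrite mem_head.
    have nF : \forall x \near pi y, normc (F x - F (pi y)) < e.
      exact: (@cvg_normcP R X (nbhs (pi y)) _ F (F (pi y))).1
      (@subalg_continuous _ _ _ UA F AF (pi y)) _ e0.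
    apply: (@filterS2 _ _ (nbhs_filter (pi y)) _ _ _ _ nF (IH ALs)) => x hF hL G.
    rewrite inE => /orP[/eqP -> {G} Fy|]; last exact: hL.
    by rewrite -Fy.
  exact: zero_neighbourhoods_proj.
(* The product over the branches that miss g y is non-zero at y, and vanishes
   at the points where g takes the value of such a branch. *)
have other_branches : \forall z \near zero_neighbourhoods B y,
    exists F, [/\ F \in L, F (pi y) = g y & g z = F (pi z)].
  exists (\prod_(F <- [seq F <- L | F (pi y) != g y]) (g - (F \o pi))); split.
  - apply: prod_branches_in => // F; rewrite mem_filter => /andP[_]; exact: AL.
  - rewrite fct_prodE; apply/eqP; rewrite prodf_seq_neq0; apply/allP => F.
    rewrite mem_filter => /andP[Fy _] /=.
    by rewrite -[X in X != 0]/(g y - F (pi y)) subr_eq0 eq_sym.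
  - move=> z nz; apply: prod_branches_eq0; have [F FL gF] := gL z.
    exists F => //; rewrite mem_filter FL andbT; apply/eqP => Fy.
    by apply: nz; exists F.
apply: filterS2 near_branch other_branches => z hz [F [FL Fy ->]].
exact: hz.
Qed.

End Branched.

(** * The logarithmic extension *)

(** Over V k two logarithms of a differ by 2 pi i n, and if both are bounded
    by r then |n| <= r / pi: the branches are the b k + 2 pi i n with n in this
    range. *)
Lemma norm_parameter_branches (R : realType) (X : topologicalType)
    (A : set (X -> R[i])) (a : X -> R[i]) (r : R) :
  unital_closed_subalgebra A -> norm_parameter A a r ->
  exists (m : nat) (V : 'I_m -> set X) (L : 'I_m -> seq (X -> R[i])),
  [/\ forall k, open (V k), forall x, exists k, V k x,
      forall k, {in L k, forall F, A F},
      forall k F x, F \in L k -> V k x -> cexp (F x) = a x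
    & forall k x z, V k x -> normc z <= r -> cexp z = a x ->
        exists2 F, F \in L k & z = F x].
Proof.
move=> UA [r0 [m [b [V [Ab oV cV bV br]]]]].
pose N := Num.bound (r / pi).
pose ints : seq int :=
  [seq Posz i | i <- iota 0 N.+1] ++ [seq - Posz i | i <- iota 0 N.+1].
pose L k := [seq (fun x => b k x + two_pi_i n) | n <- ints].
exists m, V, L; split => //.
- move=> x; have [k _ Vk] : (\bigcup_k V k) x by rewrite cV.
  by exists k.
- move=> k F /mapP[n _ ->]; apply: (subalgD UA (Ab k)).
  exact: (subalg_cst UA (two_pi_i n)).
- by move=> k F x /mapP[n _ ->] Vx; rewrite cexpD2pii bV.
- move=> k x z Vx zr ez.
  have [|n zE] := @cexp_eq R z (b k x); first by rewrite ez bV.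
  exists (fun x => b k x + two_pi_i n) => //; apply/mapP; exists n => //.
  have pi0 := pi_gt0 R.
  have nN : `|n|%:~R < N%:R :> R.
    apply: le_lt_trans (archi_boundP (divr_ge0 (ltW r0) (ltW pi0))).
    rewrite ler_pdivlMr//.
    have := normc_two_pi_i (R := R) n.
    have -> : two_pi_i n = z - b k x by rewrite zE addrC addKr.
    have := le_normcD z (- b k x); rewrite normcN.
    have := br k x; rewrite normcE lecR; lra.
  rewrite mem_cat; apply/orP; case: n nN {zE} => i.
    left; apply: (map_f Posz); rewrite mem_iota ltnS.
    by apply: ltnW; rewrite -(ltr_nat R); exact: nN.
  right; rewrite NegzE; apply: (map_f (fun i => - Posz i)).
  rewrite mem_iota ltnS.
  by apply: ltnW; rewrite -(ltr_nat R); move: nN; rewrite NegzE normrN.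
Qed.

Section LogExtension.
Context {R : realType} {Omega : topologicalType} {A : set (Omega -> R[i])}.
Context {t : (Omega -> R[i]) -> R} {S : set (Omega -> R[i])}.
Context (UA : uniform_algebra A) (SA : S `<=` invertibles A).
Let Y := log_space t S.
Let B : set (Y -> R[i]) := log_extension A t S.
Let proj : Y -> Omega := @log_proj R Omega t S.
Let coord : S -> Y -> R[i] := @log_coord R Omega t S.
Let UAu := uniform_algebra_unital UA.

Lemma log_generators_continuous (f : Y -> R[i]) :
  ([set f \o proj | f in A] `|` range coord) f -> continuous f.
Proof.
case=> [[g Ag <-] y|[a _ <-]]; last exact: log_coord_continuous.
apply: (@continuous_comp _ _ _ proj g); first exact: log_proj_continuous.
exact: (subalg_continuous UAu Ag).
Qed.

Lemma log_extension_proj f : A f -> B (f \o proj).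
Proof. by move=> Af; apply: sub_gen_smallest; left; exists f. Qed.

Lemma log_extension_coord a : B (coord a).
Proof. by apply: sub_gen_smallest; right; exists a. Qed.

Lemma log_extension_unital : unital_closed_subalgebra B.
Proof.
split.
  by apply: generated_closed_subalgebraP => f; exact: log_generators_continuous.
by move=> c; exact: (log_extension_proj (subalg_cst UAu c)).
Qed.

Let UB := log_extension_unital.

Lemma log_extension_separates : separates_points B.
Proof.
move=> y z yz; apply: contrapT => h; apply: yz; apply: log_space_eq.
  apply: contrapT => /(ua_separates_points UA)[f Af fyz]; apply: h.
  by exists (f \o proj) => //; exact: log_extension_proj.
move=> a; apply: contrapT => ayz; apply: h.
by exists (coord a) => //; exact: log_extension_coord.
Qed.

Lemma log_extension_uniform_algebra : uniform_algebra B.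
Proof.
have cB f : B f -> continuous f by move=> Bf; exact: (subalg_continuous UB Bf).
split.
- apply: log_space_compact; first exact: ua_compact UA.
  move=> a; have [Aa _] := SA (set_valP a); exact: (subalg_continuous UAu Aa).
- apply: (@hausdorff_separated R) => y z /log_extension_separates[f Bf fyz].
  by exists f => //; exact: cB.
- exact: UB.1.
- exact: UB.2.
- exact: log_extension_separates.
Qed.

Context (tA : forall a, invertibles A a -> norm_parameter A a (t a)).

Lemma log_coord_finitely_branched a : finitely_branched proj A (coord a).
Proof.
have [m [V [L [_ cV AL _ VL]]]] :=
  norm_parameter_branches UAu (tA (SA (set_valP a))).
exists (flatten [seq L k | k : 'I_m]); split=> [F|y].
  by move=> /flatten_mapP[k _]; exact: AL.
have [k Vk] := cV (proj y).
have [F FL Fy] := VL _ _ _ Vk (log_coord_bound a y) (cexp_log_coord a y).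
by exists F => //; apply/flatten_mapP; exists k; rewrite ?mem_enum.
Qed.

(** The uniform closure of the finitely branched functions of B is a closed
    subalgebra that contains the generators. *)
Lemma finitely_branched_dense :
  B `<=` closure ([set g | B g /\ finitely_branched proj A g]
                    : set {uniform Y -> R[i]}).
Proof.
have cY := ua_compact log_extension_uniform_algebra.
apply: smallest_sub.
  apply: uniform_closure_subalgebra => //.
    by apply: finitely_branched_subalgebra.
  by move=> f [Bf _]; exact: (subalg_continuous UB Bf).
move=> f gf; apply: subset_closure; split; first exact: sub_gen_smallest.
case: gf => [[g Ag <-]|[a _ <-]]; last exact: log_coord_finitely_branched.
exists [:: g]; split=> [F|y]; first by rewrite inE => /eqP ->.
by exists g; rewrite ?mem_head.
Qed.

Lemma log_extension_invertibles_dense :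
  invertibles_dense A -> invertibles_dense B.
Proof.
move=> dA g Bg; apply/uniform_closureP => e e0.
have e2 : 0 < e / 2 by rewrite divr_gt0.
have [g' [Bg' [L [AL gL]]] gg'] :=
  (uniform_closureP _ _).1 (finitely_branched_dense Bg) _ e2.
have [h [Ah he hL]] := shift_all_invertible (ua_compact UA) UAu dA AL e2.
exists (g' - (h \o proj)).
  exact: (shift_branched_invertible UAu UB log_extension_proj Bg' Ah AL gL hL).
move=> y; rewrite -[X in normc X]/(g y - (g' y - h (proj y))).
rewrite opprB addrCA addrC.
apply: le_trans (le_normcD _ _) _; rewrite [leRHS]splitr lerD//.
Qed.

Context (RA : regular A).

(** On A the character is evaluation at some x.  Its values on the coordinates
    complete x to a point y, and the elements of B on which it agrees with
    evaluation at y form a closed subalgebra, because characters are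
    contractive. *)
Lemma log_extension_natural (phi : B -> R[i]) :
  is_character phi -> exists y, is_evaluation phi y.
Proof.
move=> cphi; pose psi := extend_character phi.
pose chi (f : A) : R[i] := psi (set_val f \o proj).
have BA (f : A) : B (set_val f \o proj).
  by apply: log_extension_proj; exact: set_valP.
have [|x xE] := regular_natural UA RA (phi := chi).
  split.
  - move=> f g h e; rewrite /chi e.
    exact: (characterD UB cphi (BA f) (BA g)).
  - move=> c f h e; rewrite /chi e.
    exact: (characterZ UB cphi c (BA f)).
  - move=> f g h e; rewrite /chi e.
    exact: (characterM UB cphi (BA f) (BA g)).
  - exists (subalg_elt (subalg1 UAu)); rewrite /chi.
    by rewrite [psi _](character1 UB cphi); apply/eqP; exact: oner_neq0.
have psix f (Af : A f) : psi (f \o proj) = f x := xE (subalg_elt Af).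
pose l (a : S) := psi (coord a).
have hl : log_set t S (x, l).
  move=> a /=; split.
    rewrite normcE lecR.
    apply: (character_bound UB cphi (log_extension_coord a)).
    exact: log_coord_bound.
  have [m [V [L [oV cV AL aL VL]]]] :=
    norm_parameter_branches UAu (tA (SA (set_valP a))).
  have [k Vk] := cV x.
  have [F FL lF] : exists2 F, F \in L k & l a = F x.
    apply: (character_in_branches (V := V k) UB log_extension_proj cphi psix).
    - have [|f fE] := regular_bump UA RA (open_closedC (oV k)) (x := x).
        by [].
      by exists f.
    - exact: log_extension_coord.
    - exact: AL.
    - move=> y Vy.
      exact: (VL _ _ _ Vy (log_coord_bound a y) (cexp_log_coord a y)).
  by rewrite lF; exact: aL FL Vk.
pose y := log_point hl.
suff E : B `<=` [set g | B g /\ psi g = g y].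
  exists y => a; rewrite -(extend_characterE phi a).
  exact: (E _ (set_valP a)).2.
apply: smallest_sub; last first.
  move=> g gg; split; first exact: sub_gen_smallest.
  by case: gg => [[f Af <-]|[a _ <-]] //; exact: psix.
split; first split.
- split; first exact: (subalg0 UB).
  exact: (character0 UB cphi).
- move=> f g [Bf fE] [Bg gE]; split; first exact: (subalgD UB).
  by rewrite /psi (characterD UB cphi)// -/psi fE gE.
- move=> c f [Bf fE]; split; first exact: (subalgZ UB).
  by rewrite /psi (characterZ UB cphi)// -/psi fE.
- move=> f g [Bf fE] [Bg gE]; split; first exact: (subalgM UB).
  by rewrite /psi (characterM UB cphi)// -/psi fE gE.
- by move=> f [Bf _]; exact: (subalg_continuous UB Bf).
- apply/uniform_closedP => f hf.
  have Bf : B f.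
    apply: (subalg_closed UB) => e e0; have [g [Bg _] fg] := hf _ e0.
    by exists g.
  split => //; apply: normc_small_eq => e e0.
  have [g [Bg gE] fg] := hf _ (divr_gt0 e0 (ltr0n R 2)).
  have -> : psi f - f y = psi (f - g) + (g y - f y).
    by rewrite /psi (characterB UB cphi)// -/psi gE addrA subrK.
  apply: le_trans (le_normcD _ _) _; rewrite [leRHS]splitr lerD//.
    by apply: (character_bound UB cphi) => //; exact: (subalgB UB).
  by rewrite normc_sub.
Qed.

(** The complement of E is a neighbourhood of y, and the filter of sets outside
    of which an element of B vanishes without vanishing at y converges to y. *)
Lemma log_extension_bump (E : set Y) (y : Y) : closed E -> ~ E y ->
  exists b, [/\ B b, b y = 1 & forall z, E z -> b z = 0].
Proof.
move=> cE nEy.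
have FF := zero_neighbourhoods_filter UB y.
have cvF : zero_neighbourhoods B y --> y.
  apply: log_space_cvg.
    apply: (zero_neighbourhoods_proj log_extension_proj) => F x.
    exact: regular_bump.
  move=> a; apply: (zero_neighbourhoods_branched UAu UB log_extension_proj).
  - move=> F x; exact: regular_bump.
  - exact: log_extension_coord.
  - exact: log_coord_finitely_branched.
have [b [Bb by0 bE]] : zero_neighbourhoods B y (~` E).
  by apply: cvF; apply: open_nbhs_nbhs; split => //; exact: closed_openC.
exists ((b y)^-1 *: b); split; first exact: (subalgZ UB).
  by rewrite -[LHS]/((b y)^-1 * b y) mulVf//; apply/eqP.
by move=> z Ez; rewrite -[LHS]/((b y)^-1 * b z) (bE z) ?mulr0//.
Qed.

(** Since all characters of B are evaluations, a bump on the space gives one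
    on the character space. *)
Lemma log_extension_regular : regular B.
Proof.
move=> E w cE nEw.
have UBa := log_extension_uniform_algebra.
have [y yE] := log_extension_natural (set_valP w).
have ev v z : is_evaluation (set_val v) z -> v = evaluation UBa z.
  by move=> vz; apply: val_inj; apply/funext.
have [||b [Bb b1 b0]] := @log_extension_bump (evaluation UBa @^-1` E) y.
- apply: (closed_comp _ cE) => z _; exact: evaluation_continuous.
- by rewrite /= -(ev w y).
exists (subalg_elt Bb); split; last by rewrite -b1; exact: yE.
move=> _ [v Ev <-]; have [z zE] := log_extension_natural (set_valP v).
suff b0z : b z = 0 by rewrite /= -b0z; exact: zE.
by apply: b0; rewrite /= -(ev v z).
Qed.

End LogExtension.

Theorem corollary5p3p4p3 (R : realType) (Omega : topologicalType)
    (A : set (Omega -> R[i])) (t : (Omega -> R[i]) -> R)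
    (S : set (Omega -> R[i])) :
  uniform_algebra A -> regular A ->
  (forall a, invertibles A a -> norm_parameter A a (t a)) ->
  S `<=` invertibles A ->
  (uniform_algebra (log_extension A t S) /\ regular (log_extension A t S)) /\
  (invertibles_dense A -> invertibles_dense (log_extension A t S)).
Proof.
move=> UA RA tA SA; split; first split.
- exact: log_extension_uniform_algebra.
- exact: log_extension_regular.
- exact: log_extension_invertibles_dense.
Qed.
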